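(* Let $\Lambda\colon\mathbb{R}\to[0,1]$ be right lower semicontinuous, i.e. $\liminf_{y\downarrow x}\Lambda(y)\ge\Lambda(x)$ for all $x\in\mathbb{R}$, and assume that $Q_\Lambda^-(F)\in\mathbb{R}$ for all $F\in\mathcal M$. Then $Q_\Lambda^-$ has the CxLS property.
   Context: $\mathcal M$ is the set of cumulative distribution functions on $\mathbb{R}$. For $F\in\mathcal M$, $Q_\Lambda^-(F):=\inf\{x\in\mathbb{R}\mid F(x)\ge\Lambda(x)\}$, with $\inf\varnothing=\infty$. A functional $\rho$ on $\mathcal M$ has the CxLS property (convex level sets with respect to mixtures) if for all $F,G\in\mathcal M$, $c\in\mathbb{R}$ and $\lambda\in(0,1)$: $\rho(F)=\rho(G)=c$ implies $\rho(\lambda F+(1-\lambda)G)=c$. *)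

(* Defs.v *)
From HB Require Import structures.
From mathcomp Require Import all_boot all_order all_algebra.
From mathcomp Require Import all_classical all_reals all_analysis.

Set Implicit Arguments.
Unset Strict Implicit.
Unset Printing Implicit Defensive.

Import Order.TTheory GRing.Theory Num.Theory.
Import numFieldNormedType.Exports.

Local Open Scope classical_set_scope.
Local Open Scope ring_scope.

(* Nondecreasing right-continuous functions with limits 0 at -oo and 1 at +oo. *)
Definition cdfType (R : realType) := cumulativeBounded (0 : R) (1 : R).

Definition mixture (R : realType) (lam : R) (lam01 : 0 < lam < 1)
  (F G : cdfType R) : R -> R := fun x => lam * F x + (1 - lam) * G x.

Section mixture_cdf.
Context (R : realType) (lam : R) (lam01 : 0 < lam < 1) (F G : cdfType R).

Let mixture_nd : nondecreasing (mixture lam01 F G).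
Proof.
case/andP: lam01 => l0 l1 x y xy; rewrite /mixture lerD//.
- by rewrite ler_pM2l// cumulative_is_nondecreasing.
- by rewrite ler_pM2l ?subr_gt0// cumulative_is_nondecreasing.
Qed.

Let mixture_rc : right_continuous (mixture lam01 F G).
Proof.
move=> x; apply: cvgD; apply: cvgMl_tmp;
  exact: cumulative_is_right_continuous.
Qed.

Let mixture_Ny : mixture lam01 F G @ -oo --> (0 : R).
Proof.
rewrite [X in _ --> X](_ : 0 = lam * 0 + (1 - lam) * 0);
  last by rewrite !mulr0 addr0.
by apply: cvgD; apply: cvgMl_tmp; exact: cumulativeNy.
Qed.

Let mixture_y : mixture lam01 F G @ +oo --> (1 : R).
Proof.
rewrite [X in _ --> X](_ : 1 = lam * 1 + (1 - lam) * 1);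
  last by rewrite !mulr1 addrC subrK.
by apply: cvgD; apply: cvgMl_tmp; exact: cumulativey.
Qed.

HB.instance Definition _ :=
  isCumulative.Build R _ R (mixture lam01 F G) mixture_nd mixture_rc.

HB.instance Definition _ :=
  isCumulativeBounded.Build R 0 1 (mixture lam01 F G) mixture_Ny mixture_y.

End mixture_cdf.

(* In \bar R, the infimum of the empty set is +oo, and that of a set unbounded
   below is -oo. *)
Definition lambda_quantile (R : realType) (Lambda : R -> R) (F : cdfType R)
  : \bar R := ereal_inf [set x%:E | x in [set x : R | Lambda x <= F x]].

Definition right_lower_semicontinuous (R : realType) (f : R -> R) : Prop :=
  forall x : R, ((f x)%:E <= limf_einf (EFin \o f) x^'+)%E.

Definition CxLS (R : realType) (rho : cdfType R -> \bar R) : Prop :=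
  forall (F G : cdfType R) (c lam : R) (lam01 : 0 < lam < 1),
    rho F = c%:E -> rho G = c%:E -> rho (mixture lam01 F G) = c%:E.

(* Main.v *)
Require Import Defs.
From mathcomp Require Import all_boot all_order all_algebra.
From mathcomp Require Import all_classical all_reals all_analysis.
From mathcomp Require Import lra.

(* The infimum defining the quantile is attained: on the right of a point [c]
   with [F c < Lambda c], right-continuity of [F] and right lower
   semicontinuity of [Lambda] keep [F < Lambda] on some interval [`]c, c + e[].
   Hence a quantile [c] is characterised by [Lambda c <= F c] together with
   [F < Lambda] on the left of [c], and both conditions pass to convex
   combinations. *)

Import Order.TTheory GRing.Theory Num.Theory.
Import numFieldNormedType.Exports.

Local Open Scope classical_set_scope.
Local Open Scope ring_scope.

(** The lower limit is the supremum, over right neighbourhoods [A] of [x], of the infimum of [f] on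
    [A]; being above [a], it has one such infimum above [a]. *)
Lemma right_lower_semicontinuous_near {R : realType} {f : R -> R} {x a : R} :
  right_lower_semicontinuous f -> a < f x -> \forall y \near x^'+, a < f y.
Proof.
move=> /(_ x) fx ax.
have : (a%:E < limf_einf (EFin \o f) x^'+)%E.
  by apply: lt_le_trans fx; rewrite lte_fin.
rewrite limf_einfE => /ereal_sup_gt[_ [A xA <-] aA].
apply: filterS xA => y Ay.
rewrite -lte_fin; apply: (lt_le_trans aA).
by apply: ereal_inf_lbound; exists y.
Qed.

Lemma right_continuous_near_lt {R : realType} {f : R -> R} {x a : R} :
  right_continuous f -> f x < a -> \forall y \near x^'+, f y < a.
Proof. by move=> /(_ x) fx xa; apply: cvgr_lt fx _ xa. Qed.

Lemma lambda_quantileP {R : realType} {Lambda : R -> R} {F : cdfType R}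
    {c : R} : right_lower_semicontinuous Lambda ->
  lambda_quantile Lambda F = c%:E <->
  Lambda c <= F c /\ forall x, x < c -> F x < Lambda x.
Proof.
move=> Lrlsc; split=> [Qc|[Lc ltL]]; last first.
  apply/eqP; rewrite eq_le; apply/andP; split.
    by apply: ereal_inf_lbound; exists c.
  apply: le_ereal_inf_tmp => _ [x /= Lx <-].
  rewrite lee_fin leNgt; apply/negP => /ltL.
  by rewrite ltNge Lx.
have ltL x : x < c -> F x < Lambda x.
  move=> xc; rewrite ltNge; apply/negP => Lx.
  suff : (c%:E <= x%:E)%E by rewrite lee_fin leNgt xc.
  by rewrite -Qc; apply: ereal_inf_lbound; exists x.
split=> //; rewrite leNgt; apply/negP => Fc.
(* The midpoint is a constant separating [F] from [Lambda] just right of [c]. *)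
have [Fm mL] := (midf_lt Fc).
have near_lt : \forall y \near c^'+, F y < Lambda y.
  near=> y; apply: (@lt_trans _ _ ((F c + Lambda c) / 2)); near: y.
    exact: right_continuous_near_lt (cumulative_is_right_continuous F) Fm.
  exact: right_lower_semicontinuous_near Lrlsc mL.
have [e /= e0 ce] := near_lt.
(* [F < Lambda] now holds on all of [x < c + e], so the infimum [c] would be at least [c + e]. *)
suff : ((c + e)%:E <= c%:E)%E by rewrite lee_fin gerDl leNgt e0.
rewrite -Qc; apply: le_ereal_inf_tmp => _ [x /= Lx <-].
rewrite lee_fin leNgt; apply/negP => xce.
suff : F x < Lambda x by rewrite ltNge Lx.
have [/ltL//|cx|->//] := ltgtP x c.
by apply: ce => //=; rewrite ltr_distlC; apply/andP; split=> //; lra.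
Unshelve. all: by end_near.
Qed.

Theorem proposition6p1 (R : realType) (Lambda : R -> R)
  (Lambda01 : forall x : R, 0 <= Lambda x <= 1)
  (Lambda_rlsc : right_lower_semicontinuous Lambda)
  (Q_fin : forall F : cdfType R, lambda_quantile Lambda F \is a fin_num) :
  CxLS (lambda_quantile Lambda).
Proof.
move=> F G c lam lam01.
move=> /(lambda_quantileP Lambda_rlsc)[Fc Fx].
move=> /(lambda_quantileP Lambda_rlsc)[Gc Gx].
have /andP[l0 l1] := lam01.
(* The weights [lam] and [1 - lam] are positive with sum 1, so bounds by the same value of [Lambda]
   survive mixing. *)
apply/(lambda_quantileP Lambda_rlsc); split=> [|x xc]; rewrite /= /mixture.
  by nra.
by have := Fx x xc; have := Gx x xc; nra.
Qed.
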